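(* Let $m\ge n\ge 2$ be integers, let $(a_{ijkl})$ ($1\le i,k\le m$, $1\le j,l\le n$) be real numbers with $a_{ijkl}=a_{klij}$, and let $f(\mathbf x,\mathbf y)=\sum_{i,k=1}^m\sum_{j,l=1}^n a_{ijkl}x_iy_jx_ky_l$ for $\mathbf x\in\mathbb R^m$, $\mathbf y\in\mathbb R^n$. Suppose that $f$ is PSD. For $\Gamma\in\mathbb R^{\binom m2\times\binom n2}$ let $M(\Gamma)=B+P(\Gamma)\in\mathbb R^{mn\times mn}$ be the symmetric matrix defined in the context, so that $f(\mathbf x,\mathbf y)=(\mathbf x\otimes\mathbf y)^\top M(\Gamma)(\mathbf x\otimes\mathbf y)$. Then the following three statements are equivalent. (i) $f$ is SOS, with its SOS rank at most $mn$, and the coefficient vectors of the squares can be chosen orthogonal to each other; that is, $f(\mathbf x,\mathbf y)=\sum_{t=1}^{T}(\mathbf c_t^\top(\mathbf x\otimes\mathbf y))^2$ for some $T\le mn$ and pairwise orthogonal $\mathbf c_1,\dots,\mathbf c_T\in\mathbb R^{mn}$. (ii) There exists $\Gamma\in\mathbb R^{\binom m2\times\binom n2}$ such that $M(\Gamma)$ is positive semidefinite. (iii) $\displaystyle\max_{\Gamma\in\mathbb R^{\binom m2\times\binom n2}}\ \min_{\mathbf z\in\mathbb R^{mn},\ \mathbf z^\top\mathbf z=1}\mathbf z^\top M(\Gamma)\mathbf z\ge 0$.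
   Context: A real polynomial is PSD if it takes nonnegative values at all real points; it is SOS if it is a finite sum of squares of real polynomials; its SOS rank is the least number of squares in such a representation. For $1\le i\le m$, $1\le j\le n$ put $n_{ij}=(i-1)n+j$; the vector $\mathbf x\otimes\mathbf y\in\mathbb R^{mn}$ has entry $x_iy_j$ in position $n_{ij}$. The matrix $B\in\mathbb R^{mn\times mn}$ is the flattening of $(a_{ijkl})$: its entry in row $n_{ij}$ and column $n_{kl}$ is $a_{ijkl}$. For indices $p\ne q$ put $t_{pq}=\frac{(p-1)(p-2)}2+q$ if $p>q$ and $t_{pq}=\frac{(q-1)(q-2)}2+p$ if $p<q$ (an enumeration of unordered pairs). For $\Gamma=(\gamma_{st})\in\mathbb R^{\binom m2\times\binom n2}$, the matrix $P(\Gamma)\in\mathbb R^{mn\times mn}$ has, in row $n_{i_1j_1}$ and column $n_{i_2j_2}$, the entry - $\gamma_{t_{i_1i_2}\,t_{j_1j_2}}$ if ($i_1<i_2$ and $j_1<j_2$) or ($i_1>i_2$ and $j_1>j_2$); - $-\gamma_{t_{i_1i_2}\,t_{j_1j_2}}$ if ($i_1<i_2$ and $j_1>j_2$) or ($i_1>i_2$ and $j_1<j_2$); - $0$ if $i_1=i_2$ or $j_1=j_2$. Finally $M(\Gamma)=B+P(\Gamma)$. *)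

(* Defs.v *)
From mathcomp Require Import all_boot all_order all_algebra.
From mathcomp Require Import classical_sets reals.
From mathcomp Require Import mpoly mxtens.

Set Implicit Arguments.
Unset Strict Implicit.
Unset Printing Implicit Defensive.

Import Order.TTheory GRing.Theory Num.Theory.
Local Open Scope ring_scope.

Section RealPolynomials.
Variables (R : realType) (N : nat).
Implicit Type p : {mpoly R[N]}.

Definition psd_poly p : Prop := forall v : 'I_N -> R, 0 <= p.@[v].

Definition sos_with (T : nat) p : Prop :=
  exists q : 'I_T -> {mpoly R[N]}, p = \sum_(t < T) q t ^+ 2.

Definition sos_poly p : Prop := exists T : nat, sos_with T p.

Definition is_sos_rank p (r : nat) : Prop :=
  sos_with r p /\ forall T : nat, sos_with T p -> (r <= T)%N.

End RealPolynomials.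

Section Extrema.
Variable R : realType.
Implicit Types (E : set R) (v : R).

Definition is_min E v : Prop := E v /\ lbound E v.
Definition is_max E v : Prop := E v /\ ubound E v.

End Extrema.

Section QuadraticForms.
Variables (R : realType) (N : nat).
Implicit Types (A : 'M[R]_N) (z : 'cV[R]_N).

Definition qform A z : R := (z^T *m A *m z) 0 0.

Definition psd_mx A : Prop := A^T = A /\ forall z, 0 <= qform A z.

Definition sphere_values A : set R :=
  [set qform A z | z in [set z : 'cV[R]_N | (z^T *m z) 0 0 = 1]]%classic.

End QuadraticForms.

(* With 0-based indices, the position in the enumeration of the unordered pair
   {p, q} is (p' (p' - 1)) / 2 + q' = 'C(p', 2) + q' for p' > q'. *)
Section PairIndex.
Variable m : nat.

Lemma pair_index_subproof (p q : 'I_m) :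
  p != q -> ('C(maxn p q, 2) + minn p q < 'C(m, 2))%N.
Proof.
wlog lt_qp : p q / (q < p)%N => [hw | _].
  move=> npq; have : (val p != val q) by [].
  rewrite neq_ltn => /orP[h | h]; last exact: (hw p q h npq).
  by rewrite maxnC minnC; apply: (hw q p h); rewrite eq_sym.
rewrite (maxn_idPl (ltnW lt_qp)) (minn_idPr (ltnW lt_qp)).
apply: (@leq_trans 'C(p.+1, 2)); last exact: leq_bin2l.
by rewrite binS bin1 ltn_add2l.
Qed.

Definition pair_index (p q : 'I_m) (npq : p != q) : 'I_('C(m, 2)) :=
  Ordinal (pair_index_subproof npq).

Lemma pair_index_sym (p q : 'I_m) (npq : p != q) (nqp : q != p) :
  pair_index npq = pair_index nqp.
Proof. by apply: val_inj; rewrite /= maxnC minnC. Qed.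

End PairIndex.

(* [mxtens_index (i, j)] has value i * n + j, and [mxtens_unindex] is its
   inverse. *)
Section Biquadratic.
Variables (R : realType) (m n : nat).
Variable a : 'I_m -> 'I_n -> 'I_m -> 'I_n -> R.
Implicit Types (x : 'cV[R]_m) (y : 'cV[R]_n) (G : 'M[R]_('C(m, 2), 'C(n, 2))).

(* The first m of the m + n indeterminates are the x_i, the last n the y_j. *)
Definition Xvar (i : 'I_m) : {mpoly R[m + n]} := 'X_(lshift n i).
Definition Yvar (j : 'I_n) : {mpoly R[m + n]} := 'X_(rshift m j).

Definition biquad : {mpoly R[m + n]} :=
  \sum_(i < m) \sum_(k < m) \sum_(j < n) \sum_(l < n)
    a i j k l *: (Xvar i * Yvar j * Xvar k * Yvar l).

Definition biquad_val x y : R :=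
  biquad.@[fun k : 'I_(m + n) => col_mx x y k 0].

Definition tens x y : 'cV[R]_(m * n) := tensmx x y.

Definition flatB : 'M[R]_(m * n) :=
  \matrix_(r, c) a (mxtens_unindex r).1 (mxtens_unindex r).2
                   (mxtens_unindex c).1 (mxtens_unindex c).2.

Definition Pentry G (i1 : 'I_m) (j1 : 'I_n) (i2 : 'I_m) (j2 : 'I_n) : R :=
  match @decP _ (i1 != i2) idP, @decP _ (j1 != j2) idP with
  | left ni, left nj =>
      let g := G (pair_index ni) (pair_index nj) in
      if (i1 < i2)%N && (j1 < j2)%N || (i2 < i1)%N && (j2 < j1)%N
      then g else - g
  | _, _ => 0
  end.

Definition Pmx G : 'M[R]_(m * n) :=
  \matrix_(r, c) Pentry G (mxtens_unindex r).1 (mxtens_unindex r).2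
                          (mxtens_unindex c).1 (mxtens_unindex c).2.

Definition Mmx G : 'M[R]_(m * n) := flatB + Pmx G.

Lemma tensE x y i j : tens x y (mxtens_index (i, j)) 0 = x i 0 * y j 0.
Proof.
by rewrite /tens mxE mxtens_indexK /=; congr (x i _ * y j _); apply: ord1.
Qed.

Lemma biquadE x y : biquad_val x y =
  \sum_(i < m) \sum_(k < m) \sum_(j < n) \sum_(l < n)
    a i j k l * x i 0 * y j 0 * x k 0 * y l 0.
Proof.
rewrite /biquad_val /biquad raddf_sum; apply: eq_bigr => i _.
rewrite raddf_sum; apply: eq_bigr => k _.
rewrite raddf_sum; apply: eq_bigr => j _.
rewrite raddf_sum; apply: eq_bigr => l _ /=.
rewrite mevalZ !mevalM !mevalXU !col_mxEu !col_mxEd.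
by rewrite !mulrA.
Qed.

Lemma PentryE G i1 j1 i2 j2 (ni : i1 != i2) (nj : j1 != j2) :
  Pentry G i1 j1 i2 j2 =
  if (i1 < i2)%N && (j1 < j2)%N || (i2 < i1)%N && (j2 < j1)%N
  then G (pair_index ni) (pair_index nj)
  else - G (pair_index ni) (pair_index nj).
Proof.
rewrite /Pentry; case: decP => [ni' | //]; case: decP => [nj' | //].
by rewrite (bool_irrelevance ni' ni) (bool_irrelevance nj' nj).
Qed.

Lemma Pentry0l G i j1 j2 : Pentry G i j1 i j2 = 0.
Proof. by rewrite /Pentry; case: decP => // ni; case/negP: (ni). Qed.

Lemma Pentry0r G i1 i2 j : Pentry G i1 j i2 j = 0.
Proof.
rewrite /Pentry; case: decP => // ni; case: decP => // nj.
by case/negP: (nj).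
Qed.

Lemma Pentry_sym G i1 j1 i2 j2 : Pentry G i2 j2 i1 j1 = Pentry G i1 j1 i2 j2.
Proof.
have [-> | ni] := eqVneq i1 i2; first by rewrite !Pentry0l.
have [-> | nj] := eqVneq j1 j2; first by rewrite !Pentry0r.
have ni' : i2 != i1 by rewrite eq_sym.
have nj' : j2 != j1 by rewrite eq_sym.
rewrite (PentryE _ ni nj) (PentryE _ ni' nj').
by rewrite (pair_index_sym ni' ni) (pair_index_sym nj' nj) orbC.
Qed.

Lemma Pentry_swap G i1 j1 i2 j2 : Pentry G i1 j2 i2 j1 = - Pentry G i1 j1 i2 j2.
Proof.
have [-> | ni] := eqVneq i1 i2; first by rewrite !Pentry0l oppr0.
have [-> | nj] := eqVneq j1 j2; first by rewrite !Pentry0r oppr0.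
have nj' : j2 != j1 by rewrite eq_sym.
rewrite (PentryE _ ni nj) (PentryE _ ni nj') (pair_index_sym nj' nj).
have: val i1 != val i2 by [].
have: val j1 != val j2 by [].
by case: (ltngtP j1 j2); case: (ltngtP i1 i2) => //=; rewrite ?opprK.
Qed.

Lemma Mmx_sym G : (forall i j k l, a i j k l = a k l i j) -> (Mmx G)^T = Mmx G.
Proof.
by move=> ha; apply/matrixP => r c; rewrite !mxE ha Pentry_sym.
Qed.

Lemma qform_tens (F : 'I_m -> 'I_n -> 'I_m -> 'I_n -> R) x y :
  qform (\matrix_(r, c) F (mxtens_unindex r).1 (mxtens_unindex r).2
                          (mxtens_unindex c).1 (mxtens_unindex c).2) (tens x y)
  = \sum_(i < m) \sum_(k < m) \sum_(j < n) \sum_(l < n)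
      F i j k l * x i 0 * y j 0 * x k 0 * y l 0.
Proof.
have reidx (h : 'I_(m * n) -> R) :
    \sum_r h r = \sum_i \sum_j h (mxtens_index (i, j)).
  rewrite pair_big; apply: (reindex (fun ij => mxtens_index (ij.1, ij.2))).
  exists (@mxtens_unindex m n) => [[i j]|r] _ /=; first exact: mxtens_indexK.
  exact: (mxtens_unindexK r).
rewrite /qform mxE reidx.
rewrite (eq_bigr (fun k => \sum_(i < m) \sum_(j < n) \sum_(l < n)
    F i j k l * x i 0 * y j 0 * x k 0 * y l 0)); first exact: exchange_big.
move=> k _.
rewrite (eq_bigr (fun l => \sum_(i < m) \sum_(j < n)
    F i j k l * x i 0 * y j 0 * x k 0 * y l 0)).
  rewrite exchange_big; apply: eq_bigr => i _; exact: exchange_big.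
move=> l _; rewrite mxE reidx mulr_suml; apply: eq_bigr => i _.
rewrite mulr_suml; apply: eq_bigr => j _.
rewrite [X in X * _ * _]mxE [X in _ * X * _]mxE !tensE !mxtens_indexK /=.
by rewrite [_ * F i j k l]mulrC !mulrA.
Qed.

Lemma qform_Pmx G x y : qform (Pmx G) (tens x y) = 0.
Proof.
rewrite qform_tens; set S := LHS.
suff eqS : S = - S.
  have : S *+ 2 == 0 by rewrite mulr2n {2}eqS subrr.
  by rewrite mulrn_eq0 => /eqP.
rewrite {2}/S -sumrN; apply: eq_bigr => i _.
rewrite -sumrN; apply: eq_bigr => k _.
rewrite [LHS]exchange_big -sumrN; apply: eq_bigr => l _.
rewrite -sumrN; apply: eq_bigr => j _.
rewrite Pentry_swap !mulNr; congr (- _).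
rewrite -!mulrA; congr (_ * (_ * _)).
by rewrite mulrCA [RHS]mulrCA [y l 0 * _]mulrC.
Qed.

Lemma biquad_Mmx G x y :
  biquad_val x y = qform (Mmx G) (tens x y).
Proof.
transitivity (qform flatB (tens x y) + qform (Pmx G) (tens x y)).
  by rewrite qform_Pmx addr0 biquadE qform_tens.
by rewrite /qform /Mmx mulmxDr mulmxDl [RHS]mxE.
Qed.

End Biquadratic.

(* Main.v *)
(* Adding to M(Gamma) a matrix whose quadratic form vanishes on all tensors
   x (x) y does not change f; polarizing in x and then in y shows that the
   symmetric matrices with this property are exactly the P(Gamma).  Hence a
   decomposition of f into squares of bilinear forms with coefficient vectors
   c_t gives sum_t c_t c_t^T = M(Gamma) for some Gamma, and conversely an
   orthogonal eigendecomposition of a positive semidefinite M(Gamma) gives at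
   most mn squares with orthogonal coefficient vectors.  For (iii), P(Gamma) has
   zero diagonal, so the positive semidefinite M(Gamma) form a compact set, on
   which the least eigenvalue attains its maximum. *)
Require Import Defs.
From mathcomp Require Import all_boot all_order all_algebra.
From mathcomp Require Import all_classical all_reals.
From mathcomp Require Import topology normedtype derive.
From mathcomp Require Import -(notations) mpoly.
From mathcomp Require Import mxtens.
From mathcomp Require Import ring lra.

Set Implicit Arguments.
Unset Strict Implicit.
Unset Printing Implicit Defensive.

Import Order.TTheory GRing.Theory Num.Theory.
Import numFieldNormedType.Exports.
Local Open Scope ring_scope.

(** * Continuity and compactness tools *)

Section Compactness.
Variable R : realType.

Lemma continuous_add (T : topologicalType) (f g : T -> R) :
  continuous f -> continuous g -> continuous (fun x => f x + g x).
Proof. by move=> cf cg x; exact: (@continuousD R R^o) (cf x) (cg x). Qed.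

Lemma continuous_mul (T : topologicalType) (f g : T -> R) :
  continuous f -> continuous g -> continuous (fun x => f x * g x).
Proof. by move=> cf cg x; exact: continuousM (cf x) (cg x). Qed.

Lemma continuous_sum (T : topologicalType) (I : Type) (r : seq I) (P : pred I)
    (f : I -> T -> R) :
  (forall i, P i -> continuous (f i)) ->
  continuous (fun x => \sum_(i <- r | P i) f i x).
Proof.
move=> cf; elim: r => [|i r IH].
  rewrite (_ : (fun _ => _) = fun=> 0).
    by move=> x; exact: cst_continuous.
  by apply/funext => x; rewrite big_nil.
rewrite (_ : (fun _ => _) = fun x => (if P i then f i x else 0)
   + \sum_(j <- r | P j) f j x); last first.
  by apply/funext => x; rewrite big_cons; case: ifP => // _; rewrite add0r.
move=> x; apply: (@continuousD R R^o); last exact: IH.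
by case: (boolP (P i)) => [/cf|_]; [exact|exact: cst_continuous].
Qed.

Lemma closed_box_compact n (A : set 'rV[R]_n) (b : R) :
  (forall v, A v -> forall i, `|v 0 i| <= b) -> closed A -> compact A.
Proof.
move=> Ab clA.
have box : compact [set v : 'rV[R]_n | forall i, `[- b, b]%classic (v ord0 i)].
  by apply: (@rV_compact _ _ (fun=> `[- b, b]%classic)) => _;
    exact: segment_compact.
apply: (subclosed_compact clA box) => v Av i /=.
by rewrite in_itv /= -ler_norml; exact: Ab.
Qed.

Lemma closed_preimage_ge0 (T : topologicalType) (I : Type) (f : I -> T -> R) :
  (forall i, continuous (f i)) ->
  closed [set x | forall i, 0 <= f i x]%classic.
Proof.
move=> cf.
rewrite (_ : mkset _ =
  \bigcap_(i in setT) (f i @^-1` [set y | 0 <= y]))%classic.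
  apply: closed_bigI => i _.
  by apply: preimage_closed (@closed_ge _ 0) => x _; exact: cf.
by apply/seteqP; split => [x h i _|x h i]; [exact: h|exact: (h i Logic.I)].
Qed.

End Compactness.

(** * Quadratic forms and their minimum on the unit sphere *)

Section QuadraticForm.
Variables (R : realType) (N : nat).
Implicit Types (A : 'M[R]_N) (u v z : 'cV[R]_N).

Definition dot u v : R := (u^T *m v) 0 0.

Lemma dotE u v : dot u v = \sum_i u i 0 * v i 0.
Proof. by rewrite /dot mxE; apply: eq_bigr => i _; rewrite mxE. Qed.

Lemma dotC u v : dot u v = dot v u.
Proof. by rewrite !dotE; apply: eq_bigr => i _; rewrite mulrC. Qed.

Lemma dotDr u v w : dot u (v + w) = dot u v + dot u w.
Proof. by rewrite /dot mulmxDr mxE. Qed.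

Lemma dotZr u s v : dot u (s *: v) = s * dot u v.
Proof. by rewrite /dot -scalemxAr mxE. Qed.

Lemma dot0r u : dot u 0 = 0.
Proof. by rewrite /dot mulmx0 mxE. Qed.

Lemma dotDl u v w : dot (u + v) w = dot u w + dot v w.
Proof. by rewrite dotC dotDr !(dotC w). Qed.

Lemma dotZl s u v : dot (s *: u) v = s * dot u v.
Proof. by rewrite dotC dotZr dotC. Qed.

Lemma dot_ge0 v : 0 <= dot v v.
Proof. by rewrite dotE; apply: sumr_ge0 => i _; rewrite -expr2 sqr_ge0. Qed.

Lemma dot_eq0 v : dot v v = 0 -> v = 0.
Proof.
rewrite dotE => /eqP; rewrite psumr_eq0 => [/allP h|i _]; last first.
  by rewrite -expr2 sqr_ge0.
apply/matrixP => i j; rewrite ord1 mxE.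
by have := h i (mem_index_enum i); rewrite /= mulf_eq0 orbb => /eqP.
Qed.

Lemma dot_mulmx A u v : dot u (A *m v) = dot (A^T *m u) v.
Proof. by rewrite /dot trmx_mul trmxK mulmxA. Qed.

Lemma outer_mulmx u v z : u *m v^T *m z = dot v z *: u.
Proof.
by rewrite -mulmxA [v^T *m z]mx11_scalar mul_mx_scalar.
Qed.

Lemma dot_delta A r c : dot (delta_mx r 0) (A *m delta_mx c 0) = A r c.
Proof. by rewrite /dot trmx_delta -rowE -colE !mxE. Qed.

Lemma qform_dot A z : qform A z = dot z (A *m z).
Proof. by rewrite /qform /dot mulmxA. Qed.

Lemma qformE A z : qform A z = \sum_i \sum_j z i 0 * A i j * z j 0.
Proof.
rewrite qform_dot dotE; apply: eq_bigr => i _; rewrite mxE mulr_sumr.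
by apply: eq_bigr => j _; rewrite mulrA.
Qed.

Lemma qformD A B z : qform (A + B) z = qform A z + qform B z.
Proof. by rewrite !qform_dot mulmxDl dotDr. Qed.

Lemma qformN A z : qform (- A) z = - qform A z.
Proof. by rewrite /qform mulmxN mulNmx mxE. Qed.

Lemma qform_scale s A z : qform (s *: A) z = s * qform A z.
Proof. by rewrite !qform_dot -scalemxAl dotZr. Qed.

Lemma qform_scalar s z : qform s%:M z = s * dot z z.
Proof. by rewrite qform_dot mul_scalar_mx dotZr. Qed.

Lemma qform_outer v z : qform (v *m v^T) z = dot v z ^+ 2.
Proof. by rewrite qform_dot outer_mulmx dotZr (dotC z) expr2. Qed.

Lemma qform_sum (I : finType) (F : I -> 'M[R]_N) z :
  qform (\sum_t F t) z = \sum_t qform (F t) z.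
Proof.
by rewrite /qform mulmx_sumr mulmx_suml summxE.
Qed.

Lemma qform_addZ A u v s : A^T = A ->
  qform A (u + s *: v)
  = qform A u + s * (dot v (A *m u)) *+ 2 + s ^+ 2 * qform A v.
Proof.
move=> sA; rewrite !qform_dot mulmxDr -scalemxAr !dotDr !dotDl !dotZr !dotZl.
rewrite (dot_mulmx A u v) sA (dotC (A *m u) v) expr2 mulr2n !addrA.
by rewrite -!mulrA.
Qed.

Lemma qformZ A s z : qform A (s *: z) = s ^+ 2 * qform A z.
Proof. by rewrite !qform_dot -scalemxAr dotZr dotZl mulrA. Qed.

(** A zero of a nonnegative form is a minimum, so the gradient of the form, [2 A v], must vanish
    there. *)
Lemma psd_mx_kernel A v : psd_mx A -> qform A v = 0 -> A *m v = 0.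
Proof.
case=> sA pA qv; apply: dot_eq0; apply/eqP; rewrite eq_le dot_ge0 andbT.
set p := dot _ _; pose r := qform A (A *m v).
have r0 : 0 <= r by exact: pA.
have r1 : 0 < r + 1 by rewrite ltr_wpDl.
(* Otherwise qform A would become negative on moving from v along - A v. *)
pose t := p / (r + 1).
(* The added 1 keeps the denominator positive even if [r = 0]. Since [p = t (r + 1)], the new value
   [- 2 t p + t ^ 2 r] equals [- t ^ 2 (r + 2)]. *)
have tE : t * (r + 1) = p by rewrite divfK // gt_eqF.
have := pA (v + - t *: (A *m v)).
rewrite qform_addZ // qv add0r -/p -/r leNgt; apply: contraNle => p0.
have t0 : 0 < t by rewrite divr_gt0.
by nra.
Qed.

Lemma continuous_qform A : continuous (fun w : 'rV[R]_N => qform A w^T).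
Proof.
rewrite (_ : (fun _ => _) =
  fun w : 'rV[R]_N => \sum_i \sum_j w 0 i * A i j * w 0 j); last first.
  apply/funext => w; rewrite qformE; apply: eq_bigr => i _.
  by apply: eq_bigr => j _; rewrite !mxE.
apply: continuous_sum => i _; apply: continuous_sum => j _.
apply: (continuous_mul (f := fun w : 'rV[R]_N => w 0 i * A i j)
                       (g := fun w : 'rV[R]_N => w 0 j)); last first.
  exact: coord_continuous.
apply: (continuous_mul (f := fun w : 'rV[R]_N => w 0 i) (g := fun=> A i j)).
  exact: coord_continuous.
by move=> w; exact: cst_continuous.
Qed.

(** Both sides are homogeneous of degree 2 in [z], so a nonzero [z] can be normalized to unit
    length. *)
Lemma qform_ge_dot A lam : lbound (sphere_values A) lam ->
  forall z, lam * dot z z <= qform A z.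
Proof.
move=> h z; have [->|z0] := eqVneq z 0.
  by rewrite qform_dot mulmx0 dot0r mulr0.
have d0 : 0 < dot z z.
  rewrite lt_neqAle dot_ge0 andbT eq_sym.
  by apply: contraNneq z0 => /dot_eq0 ->.
have s0 : 0 < Num.sqrt (dot z z) by rewrite sqrtr_gt0.
have /h : (sphere_values A) (qform A ((Num.sqrt (dot z z))^-1 *: z)).
  exists ((Num.sqrt (dot z z))^-1 *: z) => //=.
  rewrite -/(dot _ _) dotZl dotZr mulrA -expr2 exprVn sqr_sqrtr ?ltW //.
  by rewrite mulVf ?gt_eqF.
rewrite qformZ exprVn sqr_sqrtr ?(ltW d0) // => hz.
by rewrite -ler_pdivlMr // mulrC.
Qed.

(** The sphere is closed with coordinates bounded by 1, and nonempty for [0 < N]. It is written with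
    row vectors to match the form of [EVT_min_rV]. *)
Lemma sphere_min A : (0 < N)%N ->
  exists v, dot v v = 1 /\ is_min (sphere_values A) (qform A v).
Proof.
move=> N0; pose S := [set w : 'rV[R]_N | dot w^T w^T = 1]%classic.
have S0 : (S !=set0)%classic.
  exists (delta_mx 0 (Ordinal N0)).
  by rewrite /S /= /dot trmxK trmx_delta mul_delta_mx mxE !eqxx.
have dE w : dot w^T w^T = qform 1%:M w^T by rewrite qform_scalar mul1r.
have cS : compact S.
  apply: (@closed_box_compact _ _ _ 1).
    move=> w Sw i; rewrite -(@expr_le1 _ 2) // -normrX ger0_norm ?sqr_ge0 //.
    rewrite -[leRHS]Sw dotE (bigD1 i) //= !mxE -expr2 lerDl.
    by apply: sumr_ge0 => j _; rewrite mxE -expr2 sqr_ge0.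
  rewrite (_ : S = (fun w : 'rV[R]_N => qform 1%:M w^T) @^-1` [set 1])%classic.
    apply: preimage_closed (@closed_eq _ 1) => w _; exact: continuous_qform.
  by apply/seteqP; split => w; rewrite /S /= dE.
have [w wS wmin] :=
  EVT_min_rV S0 cS (continuous_subspaceT (@continuous_qform A)).
rewrite inE in wS.
exists w^T; split => //; split; first by exists w^T.
move=> _ [z z1 <-]; rewrite -[z]trmxK; apply: wmin.
by rewrite inE /S /= trmxK.
Qed.

End QuadraticForm.

(** * Orthogonal decomposition of positive semidefinite matrices *)

Section PsdDecomposition.
Variables (R : realType) (N : nat).
Implicit Types (A : 'M[R]_N) (u v z : 'cV[R]_N).

(** Let [v] maximize the form on the sphere, with value [q]. Then [q I - A] is positive semidefinite
    and its form vanishes at [v], so [psd_mx_kernel] gives [A v = q v]. If [q] were 0, the form and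
    hence [A] would vanish. *)
Lemma psd_mx_max_eigenvector A : psd_mx A -> A != 0 ->
  exists v (lam : R), [/\ dot v v = 1, 0 < lam & A *m v = lam *: v].
Proof.
move=> pA; case: (posnP N) => [N0|N0 nA].
  by move=> /eqP[]; apply/matrixP => i; have := ltn_ord i; rewrite {2}N0.
have [v [v1 [_ vmin]]] := sphere_min (- A) N0.
have vmax z : qform A z <= qform A v * dot z z.
  by have := qform_ge_dot vmin z; rewrite !qformN mulNr lerN2.
have eig : (qform A v)%:M *m v - A *m v = 0.
  rewrite -mulmxBl; apply: psd_mx_kernel.
    split; first by rewrite linearB /= tr_scalar_mx; case: pA => ->.
    by move=> z; rewrite qformD qformN qform_scalar subr_ge0.
  by rewrite qformD qformN qform_scalar v1 mulr1 subrr.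
exists v, (qform A v); split => //; last first.
  by apply/esym/eqP; rewrite -subr_eq0 -mul_scalar_mx eig.
rewrite lt_neqAle eq_sym; case: (pA) => _ -> ; rewrite andbT.
apply: contraNneq nA => q0; apply/eqP/matrixP => i j.
have Az z : A *m z = 0.
  apply: psd_mx_kernel => //; apply/eqP; rewrite eq_le; case: (pA) => _ ->.
  by rewrite andbT; have := vmax z; rewrite q0 mul0r.
have := congr1 (fun B : 'cV_N => B i 0) (Az (delta_mx j 0)).
by rewrite -colE !mxE.
Qed.

(** Induction on the rank bound, splitting off one eigenvector at a time. The clause on the kernel
    of [A] carries the orthogonality: the new eigenvector [v] is killed by the remainder [A'], so
    the later vectors are orthogonal to [v]. *)
Lemma psd_mx_orthogonal_sum k A : psd_mx A -> (\rank A <= k)%N ->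
  exists c : 'I_k -> 'cV[R]_N,
    [/\ A = \sum_t c t *m (c t)^T,
        forall s t, s != t -> dot (c s) (c t) = 0
      & forall t z, A *m z = 0 -> dot (c t) z = 0].
Proof.
elim: k A => [|k IH] A pA rA.
  exists (fun=> 0); split=> [|[]//|[]//].
  by rewrite big_ord0; apply/eqP; rewrite -mxrank_eq0 -leqn0.
(* Once nothing remains, zero vectors pad the family to length [k.+1]. *)
have [A0|nA] := eqVneq A 0.
  exists (fun=> 0); split=> [|s t _|t z _]; rewrite ?dot0r 1?dotC ?dot0r //.
  by rewrite A0 big1 // => t _; rewrite mul0mx.
have [v [lam [v1 lam0 Av]]] := psd_mx_max_eigenvector pA nA.
case: (pA) => sA qA.
have vA : v^T *m A = lam *: v^T by rewrite -{1}sA -trmx_mul Av linearZ.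
pose A' := A - lam *: (v *m v^T).
have A'E : A' = (1%:M - v *m v^T) *m A.
  by rewrite mulmxBl mul1mx -mulmxA vA -scalemxAr.
have A'v : A' *m v = 0.
  by rewrite mulmxBl -scalemxAl outer_mulmx v1 scale1r Av subrr.
have pA' : psd_mx A'.
  split; first by rewrite /A' linearB linearZ /= trmx_mul trmxK sA.
  (* The form of [A'] at [z] is the form of [A] at the component of [z] orthogonal to [v]. *)
  move=> z; have := qA (z + (- dot v z) *: v).
  rewrite qform_addZ // [qform A v]qform_dot Av dotZr v1 mulr1.
  rewrite dot_mulmx sA Av dotZl.
  rewrite /A' qformD qformN qform_scale qform_outer.
  by congr (0 <= _); ring.
have rA' : (\rank A' <= k)%N.
  rewrite -ltnS; apply: leq_trans rA; apply: rank_ltmx.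
  (* The row space of [A'] lies in that of [A], strictly because [A'] kills [v] and [A] does not. *)
  rewrite /ltmx {1}A'E submxMl /=; apply/negP => /submxP[D AD].
  have : A *m v = 0 by rewrite AD -mulmxA A'v mulmx0.
  rewrite Av => /(congr1 (dot v)); rewrite dotZr v1 dot0r mulr1 => l0.
  by rewrite l0 ltxx in lam0.
have [c [Ac oc kc]] := IH A' pA' rA'.
exists (fun t => if unlift ord0 t is Some t' then c t' else Num.sqrt lam *: v).
split.
- rewrite big_ord_recl unlift_none -scalemxAl linearZ /= -scalemxAr scalerA.
  rewrite -expr2 sqr_sqrtr ?ltW //.
  under eq_bigr do rewrite liftK.
  by rewrite -Ac /A' addrC subrK.
- move=> s t; case: (unliftP ord0 s) => [s' ->|->];
    case: (unliftP ord0 t) => [t' ->|->] /=.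
  + by rewrite (inj_eq lift_inj); exact: oc.
  + by move=> _; rewrite dotZr kc // mulr0.
  + by move=> _; rewrite dotZl dotC kc // mulr0.
  + by [].
- move=> t z Az; case: (unliftP ord0 t) => [t' _|_] /=.
    by apply: kc; rewrite A'E -mulmxA Az mulmx0.
  rewrite dotZl; apply/eqP; rewrite mulf_eq0; apply/orP; right.
  have : dot (A *m v) z = 0 by rewrite -{1}sA -dot_mulmx Az dot0r.
  by rewrite Av dotZl => /eqP; rewrite mulf_eq0 gt_eqF.
Qed.

End PsdDecomposition.

(** * Inverting the enumeration of unordered pairs *)

Section PairIndexing.

(** Indices below ['C(m, 2)] come from pairs of the first [m] elements; the other [m] belong to
    pairs with the new largest element. The condition is boolean so that [xchoose] applies. *)
Lemma pair_indexP m (s : 'I_('C(m, 2))) :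
  exists p : 'I_m * 'I_m, (p.1 < p.2)%N && (val s == 'C(p.2, 2) + p.1)%N.
Proof.
elim: m s => [|m IH] [s ls] /=; first by rewrite bin0n in ls.
case: (ltnP s 'C(m, 2)) => [sm|ms].
  have [p] := IH (Ordinal sm).
  by exists (widen_ord (leqnSn m) p.1, widen_ord (leqnSn m) p.2).
have sm : (s - 'C(m, 2) < m)%N by rewrite ltn_subLR // -{2}(bin1 m) -binS.
exists (Ordinal (ltnW sm : (_ < m.+1)%N), ord_max) => /=.
by rewrite sm subnKC /=.
Qed.

Definition pair_of m (s : 'I_('C(m, 2))) : 'I_m * 'I_m :=
  xchoose (pair_indexP s).

Lemma pair_ofP m (s : 'I_('C(m, 2))) :
  ((pair_of s).1 < (pair_of s).2)%N /\
  val s = ('C((pair_of s).2, 2) + (pair_of s).1)%N.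
Proof. by have /andP[? /eqP] := xchooseP (pair_indexP s). Qed.

Lemma pair_of_neq m (s : 'I_('C(m, 2))) : (pair_of s).1 != (pair_of s).2.
Proof. by have [lt _] := pair_ofP s; rewrite -val_eqE ltn_eqF. Qed.

Lemma pair_ofK m (s : 'I_('C(m, 2))) : pair_index (pair_of_neq s) = s.
Proof.
apply: val_inj; have [lt ->] /= := pair_ofP s.
by rewrite (maxn_idPr (ltnW lt)) (minn_idPl (ltnW lt)).
Qed.

(** The indices with larger element [k] fill the interval from ['C(k, 2)] to ['C(k.+1, 2)], the
    latter excluded; these intervals are disjoint. *)
Lemma binomial2_addn_inj i k i' k' : (i < k)%N -> (i' < k')%N ->
  ('C(k, 2) + i = 'C(k', 2) + i')%N -> i = i' /\ k = k'.
Proof.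
have step j l l' j' : (j < l)%N -> (l < l')%N ->
    ('C(l, 2) + j < 'C(l', 2) + j')%N.
  move=> jl ll'; apply: (@leq_trans 'C(l.+1, 2)).
    by rewrite binS bin1 ltn_add2l.
  by apply: leq_trans (leq_addr _ _); exact: leq_bin2l.
move=> ik ik' e; case: (ltngtP k k') => [lt|lt|ek].
- by have := step _ _ _ i' ik lt; rewrite e ltnn.
- by have := step _ _ _ i ik' lt; rewrite e ltnn.
- by split=> //; apply/(@addnI 'C(k, 2)); rewrite e ek.
Qed.

Lemma pair_of_pair_index m (i k : 'I_m) (ne : i != k) : (i < k)%N ->
  pair_of (pair_index ne) = (i, k).
Proof.
move=> ik; have [lt /=] := pair_ofP (pair_index ne).
rewrite (maxn_idPr (ltnW ik)) (minn_idPl (ltnW ik)).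
move=> /(binomial2_addn_inj ik lt)[e1 e2].
by rewrite [LHS]surjective_pairing; congr pair; exact/val_inj.
Qed.

End PairIndexing.

(** * Symmetric matrices whose form vanishes on tensors *)

Section TensorKernel.
Variables (R : realType) (m n : nat).
Implicit Types (D : 'M[R]_(m * n)).

Local Notation "i ** j" := (mxtens_index (i, j)) (at level 40).

Lemma tensDl (x x' : 'cV[R]_m) (y : 'cV[R]_n) :
  tens (x + x') y = tens x y + tens x' y.
Proof.
apply/matrixP => r c; rewrite ord1 [RHS]mxE; case: r / (mxtens_indexP r) => i j.
by rewrite !tensE mxE mulrDl.
Qed.

Lemma tensDr (x : 'cV[R]_m) (y y' : 'cV[R]_n) :
  tens x (y + y') = tens x y + tens x y'.
Proof.
apply/matrixP => r c; rewrite ord1 [RHS]mxE; case: r / (mxtens_indexP r) => i j.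
by rewrite !tensE mxE mulrDr.
Qed.

Lemma tens_delta i j :
  tens (delta_mx i 0) (delta_mx j 0) = delta_mx (i ** j) 0 :> 'cV[R]_(m * n).
Proof.
apply/matrixP => r c; rewrite ord1; case: r / (mxtens_indexP r) => k l.
rewrite tensE !mxE !eqxx !andbT (can_eq (@mxtens_indexK m n)) xpair_eqE.
by rewrite -natrM mulnb.
Qed.

Lemma tens_qform0_antisym D : D^T = D ->
  (forall x y, qform D (tens x y) = 0) ->
  forall i j k l, D (i ** j) (k ** l) = - D (i ** l) (k ** j).
Proof.
move=> sD D0 i j k l.
have pol (u v : 'cV[R]_(m * n)) : qform D (u + v) = 0 -> qform D u = 0 ->
    qform D v = 0 -> dot u (D *m v) = 0.
  move=> h hu hv; move: h; rewrite -[v]scale1r qform_addZ // hu scale1r hv.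
  rewrite mulr0 addr0 add0r mul1r dot_mulmx sD dotC => /eqP.
  by rewrite mulrn_eq0 => /eqP.
(* With [y] shared, the sum of the two tensors is again a tensor, so polarization applies. *)
have polx x x' y : dot (tens x y) (D *m tens x' y) = 0.
  by apply: pol => //; rewrite -tensDl.
(* Of the four terms of the expansion in [y], the two with equal second indices vanish by [polx];
   the two cross terms must cancel. *)
have := polx (delta_mx i 0) (delta_mx k 0) (delta_mx j 0 + delta_mx l 0).
rewrite !tensDr mulmxDr !dotDr !dotDl !polx add0r addr0 !tens_delta !dot_delta.
by move=> /eqP; rewrite addrC addr_eq0 => /eqP.
Qed.

(** [G] is read off the entries with [i < k] and [j < l]. Antisymmetry in [j, l] and symmetry of [D]
    give the other orders; entries with [i = k] or [j = l] equal their own negatives. *)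
Lemma Pmx_of_tens_qform0 D : D^T = D ->
  (forall x y, qform D (tens x y) = 0) -> exists G, D = Pmx G.
Proof.
move=> sD D0; have anti := tens_qform0_antisym sD D0.
have sym r c : D r c = D c r by rewrite -{1}sD mxE.
pose G := \matrix_(s < 'C(m, 2), t < 'C(n, 2))
  D ((pair_of s).1 ** (pair_of t).1) ((pair_of s).2 ** (pair_of t).2).
have lt (i : 'I_m) (j : 'I_n) (k : 'I_m) (l : 'I_n) :
    (i < k)%N -> (j < l)%N -> Pentry G i j k l = D (i ** j) (k ** l).
  move=> ik jl.
  have nik : i != k by rewrite -val_eqE ltn_eqF.
  have njl : j != l by rewrite -val_eqE ltn_eqF.
  by rewrite (PentryE G nik njl) ik jl /= mxE !pair_of_pair_index.
have eq0 (z : R) : z = - z -> z = 0 by lra.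
have le (i : 'I_m) (j : 'I_n) (k : 'I_m) (l : 'I_n) :
    (i < k)%N -> Pentry G i j k l = D (i ** j) (k ** l).
  move=> ik; case: (ltngtP j l) => [jl|lj|/val_inj <-]; first exact: lt.
    by rewrite Pentry_swap lt // anti opprK.
  by rewrite Pentry0r [RHS]eq0.
exists G; apply/matrixP => r c; case: r / (mxtens_indexP r) => i j.
case: c / (mxtens_indexP c) => k l; rewrite mxE !mxtens_indexK /=.
case: (ltngtP i k) => [ik|ki|/val_inj <-]; first by rewrite le.
  by rewrite -Pentry_sym le.
by rewrite Pentry0l; apply: eq0; rewrite {1}anti sym.
Qed.

End TensorKernel.

(** * Gram matrices and sums of squares as polynomial identities *)

Section Polynomials.
Variables (R : realType) (m n : nat).
Implicit Type a F : 'I_m -> 'I_n -> 'I_m -> 'I_n -> R.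

Local Notation "i ** j" := (mxtens_index (i, j)) (at level 40).

(** Exchanging [j] and [l] keeps the monomial and negates the coefficient. An identity of
    polynomials, not only of values, is what SOS statements require. *)
Lemma biquad_Pentry G : biquad (@Pentry R m n G) = 0.
Proof.
set S := biquad _.
suff eqS : S = - S.
  have : 2%:R *: S = 0 by rewrite scaler_nat mulr2n {2}eqS subrr.
  by move=> /eqP; rewrite scaler_eq0 pnatr_eq0 => /eqP.
rewrite /S /biquad -sumrN; apply: eq_bigr => i _; rewrite -sumrN.
apply: eq_bigr => k _; rewrite [LHS]exchange_big -sumrN; apply: eq_bigr => j _.
rewrite -sumrN; apply: eq_bigr => l _.
by rewrite Pentry_swap scaleNr; congr (- _); congr (_ *: _); ring.
Qed.

Lemma biquad_Mmx_coef a G :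
  biquad a = biquad (fun i j k l => Mmx a G (i ** j) (k ** l)).
Proof.
rewrite -[LHS]addr0 -(biquad_Pentry G) /biquad -big_split.
apply: eq_bigr => i _; rewrite -big_split; apply: eq_bigr => k _.
rewrite -big_split; apply: eq_bigr => j _.
rewrite -big_split; apply: eq_bigr => l _.
by rewrite !mxE !mxtens_indexK /= scalerDl.
Qed.

Lemma biquad_gram T (c : 'I_T -> 'cV[R]_(m * n)) :
  biquad (fun i j k l => (\sum_t c t *m (c t)^T) (i ** j) (k ** l))
  = \sum_t (\sum_i \sum_j c t (i ** j) 0 *: (Xvar R n i * Yvar R m j)) ^+ 2.
Proof.
transitivity (\sum_t biquad (fun i j k l => c t (i ** j) 0 * c t (k ** l) 0)).
  rewrite /biquad [RHS]exchange_big; apply: eq_bigr => i _.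
  rewrite [RHS]exchange_big; apply: eq_bigr => k _.
  rewrite [RHS]exchange_big; apply: eq_bigr => j _.
  rewrite [RHS]exchange_big; apply: eq_bigr => l _.
  rewrite summxE scaler_suml; apply: eq_bigr => t _.
  by rewrite mxE big_ord1 !mxE.
apply: eq_bigr => t _; rewrite expr2 mulr_suml; apply: eq_bigr => i _.
rewrite mulr_sumr; apply: eq_bigr => k _; rewrite mulr_suml.
apply: eq_bigr => j _; rewrite mulr_sumr; apply: eq_bigr => l _.
by rewrite -scalerAl -scalerAr scalerA !mulrA.
Qed.

End Polynomials.

Lemma sos_rank_exists (R : realType) N (p : mpoly N R) T :
  sos_with T p -> exists2 r, is_sos_rank p r & (r <= T)%N.
Proof.
move=> pT; have ex : exists T, `[< sos_with T p >] by exists T; apply/asboolP.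
case: (ex_minnP ex) => r /asboolP pr rmin.
by exists r; [split=> // k /asboolP|]; [exact: rmin|apply: rmin; exact/asboolP].
Qed.

(** The form is tested at the sum and the difference of two basis vectors. *)
Lemma psd_mx_entry_bound (R : realType) N (A : 'M[R]_N) r c :
  psd_mx A -> `|A r c| *+ 2 <= A r r + A c c.
Proof.
case=> sA pA; have qd i : qform A (delta_mx i 0) = A i i.
  by rewrite qform_dot dot_delta.
have q s : 0 <= A r r + s * A r c *+ 2 + s ^+ 2 * A c c.
  have := pA (delta_mx r 0 + s *: delta_mx c 0).
  by rewrite qform_addZ // !qd dot_delta -{2}sA [A^T c r]mxE.
have := q 1; have := q (-1); rewrite sqrrN !expr1n !mul1r !mulN1r.
by case: (ger0P (A r c)) => _; rewrite !mulr2n; lra.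
Qed.

(** * Attainment of the max-min value *)

Section MaxMin.
Variables (R : realType) (m n : nat).
Variable a : 'I_m -> 'I_n -> 'I_m -> 'I_n -> R.

Let entry_sum : R := \sum_r \sum_c `|flatB a r c|.

Lemma flatB_le_sum r c : `|flatB a r c| <= entry_sum.
Proof.
rewrite /entry_sum (bigD1 r) //= (bigD1 c) //= -addrA lerDl addr_ge0 //.
  by apply: sumr_ge0.
by apply: sumr_ge0 => i _; apply: sumr_ge0.
Qed.

Lemma Mmx_diag G r : Mmx a G r r = flatB a r r.
Proof. by rewrite mxE [X in _ + X]mxE Pentry0l addr0. Qed.

Lemma Pentry_of_pairs (G : 'M[R]_('C(m, 2), 'C(n, 2))) s t :
  Pentry G (pair_of s).1 (pair_of t).1 (pair_of s).2 (pair_of t).2 = G s t.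
Proof.
rewrite (PentryE G (pair_of_neq s) (pair_of_neq t)) !pair_ofK.
by rewrite (pair_ofP s).1 (pair_ofP t).1.
Qed.

(* P(Gamma) has zero diagonal, so the diagonal of B controls every entry of a
   positive semidefinite M(Gamma). *)
Lemma psd_Mmx_bound G s t : psd_mx (Mmx a G) -> `|G s t| <= entry_sum *+ 2.
Proof.
move=> pM; rewrite -Pentry_of_pairs.
pose r := mxtens_index ((pair_of s).1, (pair_of t).1).
pose c := mxtens_index ((pair_of s).2, (pair_of t).2).
rewrite (_ : Pentry _ _ _ _ _ = Mmx a G r c - flatB a r c); last first.
  by rewrite [X in X - _]mxE addrAC subrr add0r mxE !mxtens_indexK.
(* The entries of M(Gamma) and of B at [(r, c)] are each at most [entry_sum] in absolute value,
   whence the factor 2. *)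
have := psd_mx_entry_bound r c pM; rewrite !Mmx_diag.
have := flatB_le_sum r r; have := flatB_le_sum c c; have := flatB_le_sum r c.
have := ler_norm (flatB a r r); have := ler_norm (flatB a c c).
have := ler_normB (Mmx a G r c) (flatB a r c).
by rewrite !mulr2n; lra.
Qed.

Lemma continuous_qform_Mmx (T : topologicalType)
    (g : T -> 'M[R]_('C(m, 2), 'C(n, 2))) (lam : T -> R) z :
  (forall s t, continuous (fun x => g x s t)) -> continuous lam ->
  continuous (fun x => qform (Mmx a (g x) - (lam x)%:M) z).
Proof.
move=> cg clam.
have cst (c : R) : continuous (fun _ : T => c).
  by move=> x; exact: cst_continuous.
have cP i j k l : continuous (fun x => Pentry (g x) i j k l).
  rewrite /Pentry; case: decP => // ni; case: decP => // nj.
  case: (_ || _); first exact: cg.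
  rewrite (_ : (fun _ => _) =
    fun x => -1 * g x (pair_index ni) (pair_index nj)).
    exact: continuous_mul.
  by apply/funext => x; rewrite mulN1r.
rewrite (_ : (fun _ => _) = fun x => qform (flatB a) z +
   ((\sum_r \sum_c z r 0 * Pmx (g x) r c * z c 0) + lam x * - dot z z)).
  apply: continuous_add; first exact: cst.
  apply: continuous_add; last exact: (continuous_mul clam (cst _)).
  apply: continuous_sum => r _; apply: continuous_sum => c _.
  apply: continuous_mul => //; apply: continuous_mul => //.
  rewrite (_ : (fun _ => _) = fun x => Pentry (g x) (mxtens_unindex r).1
    (mxtens_unindex r).2 (mxtens_unindex c).1 (mxtens_unindex c).2) //.
  by apply/funext => x; rewrite mxE.
apply/funext => x; rewrite -qformE qformD qformN qformD qform_scalar mulrN.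
by rewrite addrA.
Qed.

(** Rather than proving the least eigenvalue continuous in Gamma, the proof maximizes the coordinate
    [lam] over the compact set [K] of pairs [(lam, Gamma)] with [lam] nonnegative and M(Gamma) - lam
    I positive semidefinite. *)
Lemma max_min_sphere : (forall i j k l, a i j k l = a k l i j) ->
  (0 < m * n)%N -> (exists G, psd_mx (Mmx a G)) ->
  exists2 mu : R,
    is_max [set lam | exists G, is_min (sphere_values (Mmx a G)) lam]%classic mu
    & 0 <= mu.
Proof.
move=> a_sym mn0 [G0 [_ pG0]].
(* A pair is stored as a row vector: [lam] first, then the entries of Gamma. *)
pose d := (1 + 'C(m, 2) * 'C(n, 2))%N.
pose lam (w : 'rV[R]_d) := w 0 (lshift _ 0).
pose gam (w : 'rV[R]_d) : 'M[R]_('C(m, 2), 'C(n, 2)) := vec_mx (rsubmx w).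
pose pair l G : 'rV[R]_d := row_mx (l%:M : 'rV_1) (mxvec G).
have lamE l G : lam (pair l G) = l by rewrite /lam row_mxEl mxE eqxx.
have gamE l G : gam (pair l G) = G by rewrite /gam row_mxKr mxvecK.
have gam_entry w s t : gam w s t = w 0 (rshift 1 (mxvec_index s t)).
  by rewrite /gam !mxE.
(* [None] stands for the constraint on the sign of [lam], [Some z] for the inequality at [z], so
   that [K] is one intersection of closed conditions. *)
pose test (o : option 'cV[R]_(m * n)) (w : 'rV[R]_d) : R :=
  if o is Some z then qform (Mmx a (gam w) - (lam w)%:M) z else lam w.
pose K := [set w | forall o, 0 <= test o w]%classic.
have KP l G : 0 <= l -> (forall z, l * dot z z <= qform (Mmx a G) z) ->
    K (pair l G).
  move=> l0 h [z|] /=; last by rewrite lamE.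
  by rewrite lamE gamE qformD qformN qform_scalar subr_ge0.
have Kqform w z : K w -> lam w * dot z z <= qform (Mmx a (gam w)) z.
  by move=> /(_ (Some z)) /=; rewrite qformD qformN qform_scalar subr_ge0.
have Kpsd w : K w -> psd_mx (Mmx a (gam w)).
  move=> Kw; split; first exact: Mmx_sym.
  move=> z; apply: le_trans (Kqform w z Kw).
  by rewrite mulr_ge0 ?dot_ge0 //; exact: (Kw None).
have cK : compact K.
  apply: (@closed_box_compact _ _ _ (entry_sum *+ 2)).
    move=> w Kw i; case: (splitP i) => [j|j] ij; last first.
      rewrite (_ : i = rshift 1 j); last exact: val_inj.
      case/mxvec_indexP: j {ij} => s t; rewrite -gam_entry.
      exact: psd_Mmx_bound (Kpsd w Kw).
    rewrite (_ : i = lshift _ 0); last by apply: val_inj; rewrite /= ij ord1.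
    rewrite -/(lam w) ger0_norm; last exact: (Kw None).
    (* A basis vector bounds [lam] by a diagonal entry of M(Gamma), which is one of B. *)
    pose r := Ordinal mn0; have := Kqform w (delta_mx r 0) Kw.
    rewrite qform_dot dot_delta Mmx_diag -[X in dot _ X]mul1mx dot_delta.
    rewrite mxE eqxx mulr1 => lamB.
    have := flatB_le_sum r r; have := ler_norm (flatB a r r).
    have := normr_ge0 (flatB a r r).
    by rewrite mulr2n; lra.
  apply: closed_preimage_ge0 => -[z|]; last exact: coord_continuous.
  apply: continuous_qform_Mmx => [s t|]; last exact: coord_continuous.
  rewrite (_ : (fun _ => _) =
     fun w : 'rV[R]_d => w 0 (rshift 1 (mxvec_index s t))).
    exact: coord_continuous.
  by apply/funext => w; exact: gam_entry.
have K0 : (K !=set0)%classic.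
  by exists (pair 0 G0); apply: KP => // z; rewrite mul0r.
have clam : continuous lam by exact: coord_continuous.
have [w /set_mem Kw wmax] := EVT_max_rV K0 cK (continuous_subspaceT clam).
have lam0 : 0 <= lam w by exact: (Kw None).
have upper l G : is_min (sphere_values (Mmx a G)) l -> l <= lam w.
  (* A negative minimum gives no point of [K], but is below [lam w] anyway. *)
  case=> _ lmin; case: (lerP 0 l) => [l0|/ltW l0]; last exact: le_trans lam0.
  rewrite -(lamE l G); apply: wmax; apply/mem_set; apply: KP => //.
  exact: qform_ge_dot.
exists (lam w) => //; split; last by move=> l [G]; exact: upper.
(* The minimum for the optimal Gamma is at least [lam w] by membership in [K], and at most [lam w]
   by [upper]. *)
exists (gam w); have [v [v1 vmin]] := sphere_min (Mmx a (gam w)) mn0.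
suff -> : lam w = qform (Mmx a (gam w)) v by [].
apply/eqP; rewrite eq_le (upper _ _ vmin) andbT.
by have := Kqform w v Kw; rewrite v1 mulr1.
Qed.

End MaxMin.

Theorem theorem3p1 (R : realType) (m n : nat)
    (a : 'I_m -> 'I_n -> 'I_m -> 'I_n -> R)
    (le2n : (2 <= n)%N) (lenm : (n <= m)%N)
    (a_sym : forall i j k l, a i j k l = a k l i j)
    (f_psd : psd_poly (biquad a)) :
  let stmt_i :=
    [/\ sos_poly (biquad a),
        exists2 r : nat, is_sos_rank (biquad a) r & (r <= m * n)%N
      & exists (T : nat) (c : 'I_T -> 'cV[R]_(m * n)),
          [/\ (T <= m * n)%N,
              forall s t : 'I_T, s != t -> ((c s)^T *m c t) 0 0 = 0
            & forall (x : 'cV[R]_m) (y : 'cV[R]_n),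
                biquad_val a x y =
                \sum_(t < T) ((c t)^T *m tens x y) 0 0 ^+ 2]] in
  let stmt_ii :=
    exists G : 'M[R]_('C(m, 2), 'C(n, 2)), psd_mx (Mmx a G) in
  let stmt_iii :=
    exists2 mu : R,
      is_max [set lam | exists G : 'M[R]_('C(m, 2), 'C(n, 2)),
                is_min (sphere_values (Mmx a G)) lam]%classic mu
      & 0 <= mu in
  (stmt_i <-> stmt_ii) /\ (stmt_ii <-> stmt_iii).
Proof.
move=> stmt_i stmt_ii stmt_iii; split; split.
- case=> _ _ [T [c [_ _ cE]]].
  pose C := \sum_t c t *m (c t)^T.
  have qC z : qform C z = \sum_t dot (c t) z ^+ 2.
    by rewrite qform_sum; apply: eq_bigr => t _; rewrite qform_outer.
  have sC : C^T = C.
    rewrite linear_sum; apply: eq_bigr => t _.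
    by rewrite /= trmx_mul trmxK.
  (* The Gram matrix [C] and B represent the same form on tensors, so they differ by some
     P(Gamma). *)
  have [||G DG] := @Pmx_of_tens_qform0 _ m n (C - flatB a).
  + rewrite linearB /= sC; congr (_ - _).
    by apply/matrixP => r s; rewrite !mxE a_sym.
  + move=> x y; rewrite qformD qformN qC -[X in X - _](cE x y).
    by rewrite biquadE qform_tens subrr.
  exists G; rewrite /Mmx -DG addrC subrK; split=> // z.
  by rewrite qC; apply: sumr_ge0 => t _; exact: sqr_ge0.
- case=> G pM.
  have [c [ME oc _]] := psd_mx_orthogonal_sum pM (rank_leq_row _).
  have sos : sos_with (m * n) (biquad a).
    exists (fun t => \sum_i \sum_j
      c t (mxtens_index (i, j)) 0 *: (Xvar R n i * Yvar R m j)).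
    (* Replacing the coefficients by the entries of M(Gamma) leaves the polynomial unchanged. *)
    by rewrite (biquad_Mmx_coef a G) ME; exact: biquad_gram.
  split; [by exists (m * n)%N | exact: sos_rank_exists sos |].
  exists (m * n)%N, c; split=> // x y.
  rewrite (biquad_Mmx a G) ME qform_sum; apply: eq_bigr => t _.
  exact: qform_outer.
- apply: max_min_sphere => //.
  by rewrite muln_gt0 (leq_trans _ le2n) // (leq_trans _ (leq_trans le2n lenm)).
- case=> mu [[G [_ Gmin]] _] mu0; exists G; split; first exact: Mmx_sym.
  move=> z; apply: le_trans (qform_ge_dot Gmin z).
  by rewrite mulr_ge0 ?dot_ge0.
Qed.
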